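(* Let $(\Omega,\mathcal{A},\mu)$ be a complete finite measure space, let $\varphi\in\Delta_2$ be a Young function and let $\{\mathcal{A}_n\}_{n=1}^{\infty}$ be a sequence of $\sigma$-subalgebras of $\mathcal{A}$, with upper limit $\overline{\mathcal{A}}=\bigcap_{m=1}^{\infty}\bigvee_{n=m}^{\infty}\mathcal{A}_n$. Then $\mathcal{A}_n\xrightarrow{\mu}\overline{\mathcal{A}}$ if and only if for every $f\in L^{\varphi}(\mathcal{A})$, $E(f\mid\mathcal{A}_n)\to E(f\mid\overline{\mathcal{A}})$ in the norm of $L^{\varphi}(\mathcal{A})$.
   Context: A Young function is a continuous convex function $\varphi:\mathbb{R}\to\mathbb{R}$ that is even, satisfies $\varphi(x)=0$ if and only if $x=0$, and satisfies $\lim_{x\to\infty}\varphi(x)/x=\infty$ and $\lim_{x\to\infty}\varphi(x)=\infty$. We write $\varphi\in\Delta_2$ if there are constants $k>0$, $x_0>0$ with $\varphi(2x)\le k\varphi(x)$ for all $x\ge x_0$. The Orlicz space $L^{\varphi}(\mathcal{A})=L^{\varphi}(\Omega,\mathcal{A},\mu)$ is the space of (a.e. classes of) real-valued $\mathcal{A}$-measurable $f$ with $\int_\Omega\varphi(\alpha f)\,d\mu<\infty$ for some $\alpha>0$, with norm $\|f\|_\varphi=N_\varphi(f)=\inf\{k>0:\int_\Omega\varphi(|f|/k)\,d\mu\le 1\}$. For a $\sigma$-subalgebra $\mathfrak{D}\subseteq\mathcal{A}$, $E(f\mid\mathfrak{D})$ is the a.e. unique $\mathfrak{D}$-measurable function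 with $\int_D f\,d\mu=\int_D E(f\mid\mathfrak{D})\,d\mu$ for all $D\in\mathfrak{D}$. $\bigvee_{n=m}^{\infty}\mathcal{A}_n$ denotes the smallest $\sigma$-subalgebra of $\mathcal{A}$ containing $\bigcup_{n=m}^{\infty}\mathcal{A}_n$. $\mathcal{A}_n\xrightarrow{\mu}\mathfrak{D}$ means that for every $D\in\mathfrak{D}$ there is a sequence $A_n\in\mathcal{A}_n$ with $\lim_n\mu(A_n\Delta D)=0$. *)

(* Defs.v *)
From HB Require Import structures.
From mathcomp Require Import all_boot all_order all_algebra.
From mathcomp Require Import all_classical all_reals all_analysis.
From mathcomp Require Import measurable_realfun.

Set Implicit Arguments.
Unset Strict Implicit.
Unset Printing Implicit Defensive.

Import Order.TTheory GRing.Theory Num.Theory.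
Import numFieldNormedType.Exports.

Local Open Scope classical_set_scope.
Local Open Scope ring_scope.

Record young_function (R : realType) (phi : R -> R) : Prop := YoungFunction {
  young_continuous : continuous phi ;
  young_convex : convex_function (E := R^o) [set: R^o] phi ;
  young_even : forall x, phi (- x) = phi x ;
  young_eq0 : forall x, phi x = 0 <-> x = 0 ;
  young_superlinear : phi x / x @[x --> +oo] --> +oo ;
  young_coercive : phi x @[x --> +oo] --> +oo
}.

Definition Delta2 (R : realType) (phi : R -> R) : Prop :=
  exists k x0 : R, [/\ 0 < k, 0 < x0 &
    forall x, x0 <= x -> phi (2 * x) <= k * phi x].

Section sigma_subalgebras.
Context d (T : measurableType d).

Definition sigma_subalgebra (D : set (set T)) : Prop :=
  sigma_algebra [set: T] D /\ D `<=` measurable.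

Definition sigma_join (A : (set (set T))^nat) (m : nat) : set (set T) :=
  <<s \bigcup_(n in [set n | (m <= n)%N]) A n >>.

Definition upper_limit (A : (set (set T))^nat) : set (set T) :=
  \bigcap_m sigma_join A m.

End sigma_subalgebras.

Section orlicz.
Context d (T : measurableType d) (R : realType).
Variable mu : {measure set T -> \bar R}.
Local Open Scope ereal_scope.

Definition approaches_in_measure (A : (set (set T))^nat) (D : set (set T)) :
    Prop :=
  forall B, D B -> exists C : (set T)^nat,
    (forall n, A n (C n)) /\ mu (C n `+` B) @[n --> \oo] --> 0.

Definition orlicz_space (phi : R -> R) : set (T -> R) :=
  [set f | measurable_fun [set: T] f /\
    exists2 alpha : R, (0 < alpha)%R &
      \int[mu]_x (phi (alpha * f x)%R)%:E < +oo].

(* The infimum is taken in \bar R, so it is +oo (and not a default real) when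
   no k is admissible. *)
Definition orlicz_norm (phi : R -> R) (f : T -> R) : \bar R :=
  ereal_inf [set k%:E | k in [set k : R | (0 < k)%R /\
    \int[mu]_x (phi (`|f x| / k)%R)%:E <= 1]].

(* g is a version of E(f | D); measurability of g is with respect to D, as
   <<s D>> = D when D is a sigma-algebra. *)
Definition is_cond_exp (D : set (set T)) (f g : T -> R) : Prop :=
  measurable_fun [set: g_sigma_algebraType D] (g : g_sigma_algebraType D -> R)
  /\ forall B, D B -> \int[mu]_(x in B) (f x)%:E = \int[mu]_(x in B) (g x)%:E.

(* A chosen version; cond_expP below shows that the default value of xget is
   not used for integrable functions on a finite measure space. *)
Definition cond_exp (D : set (set T)) (f : T -> R) : T -> R :=
  xget (cst 0%R) [set g | is_cond_exp D f g].

End orlicz.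

Section cond_exp_exists.
Context d (T : measurableType d) (R : realType).
Variable mu : {finite_measure set T -> \bar R}.
Local Open Scope ereal_scope.

Lemma cond_expP (D : set (set T)) (f : T -> R) :
  sigma_subalgebra D -> mu.-integrable [set: T] (EFin \o f) ->
  is_cond_exp mu D f (cond_exp mu D f).
Proof.
move=> [sD DM] intf.
suff [g gP] : exists g, is_cond_exp mu D f g.
  exact: (@xgetPex _ (cst 0%R) [set g | is_cond_exp mu D f g] (ex_intro _ g gP)).
pose Y := g_sigma_algebraType D.
have mY (B : set Y) : measurable B <-> D B.
  by rewrite -[measurable B]/(<<s D >> B) sigma_algebra_id.
pose i : T -> Y := fun x => x.
have mi : measurable_fun [set: T] i.
  by move=> _ B /mY DB; rewrite setTI; exact: DM.
pose m : {measure set Y -> \bar R} :=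
  measure_function_pushforward__canonical__measure_function_Measure mu mi.
have mfin : fin_num_fun m.
  by move=> B /mY DB; apply: fin_num_measure; exact: DM.
pose mF := Measure_isFinite.Build _ _ _ m mfin.
pose m' : {finite_measure set Y -> \bar R} := HB.pack (Measure.sort m) mF.
pose nu : {charge set Y -> \bar R} :=
  measure_function_pushforward__canonical__charge_Charge (induced_charge intf) mi.
have num : nu `<< m'.
  apply: (@dominates_pushforward _ _ _ _ _ mu _ i mi).
  apply/null_content_dominatesP => A mA A0.
  apply: null_set_integral => //.
  by apply: measurable_funS (measurable_int mu intf).
pose h := Radon_Nikodym nu m'.
have hint := Radon_Nikodym_integrable num.
have hfin x := Radon_Nikodym_fin_num x num.
have hE (x : Y) : (fine (h x))%:E = h x by rewrite fineK.
have mh := measurable_int _ hint.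
exists (fine \o h : Y -> R); split.
  exact: measurableT_comp (fine_measurable measurableT) mh.
move=> B DB.
have mB : measurable (B : set Y) by apply/mY.
have -> : \int[mu]_(x in B) (f x)%:E = nu B by [].
rewrite (Radon_Nikodym_integral num mB).
rewrite [LHS](_ : _ = \int[pushforward mu i]_(x in B) h x)//.
rewrite integral_pushforward//.
  by apply: eq_integral => x _; rewrite /= hE.
apply: (integrableS measurableT) => //; first exact: DM.
apply/integrableP; split; first exact: measurableT_comp mh mi.
have /integrableP[_] := hint.
rewrite [X in X < _ -> _](_ : _ =
  \int[pushforward mu i]_(x in setT) (abse \o h) x)//.
rewrite ge0_integral_pushforward//; first exact: measurableT_comp mh.
by move=> y _; exact: abse_ge0.
Qed.

End cond_exp_exists.

(* Main.v *)
(* Write B_m for the sigma-algebra generated by A_m, A_(m+1), ..., so that the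
   upper limit Abar is the intersection of the B_m.

   Suppose A_n approaches Abar, and let u be bounded.  The functions E(u|B_m)
   form a reverse martingale: by Pythagoras int (E(u|B_m) - E(u|B_n))^2 is a
   difference of terms of a bounded monotone sequence, so E(u|B_m) is Cauchy in
   L^1, and the upper limit g of a fast subsequence is a version of E(u|Abar).
   By hypothesis g is an L^1-limit of A_n-measurable functions s_n, and since
   E(u|A_n) - s_n = E(E(u|B_n) - s_n|A_n), the contraction property in L^1 gives
   E(u|A_n) -> g in L^1.  For bounded functions this implies convergence of
   int phi(c .) for every c, by convexity.  A general f in L^phi is reduced to
   this case by truncation: Delta_2 makes int phi(c (f - u)) small, and Jensen's
   inequality bounds int phi(c E(f - u|D)) by it uniformly in D.

   Conversely, apply the convergence to the indicator function of B in Abar: the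
   sets {E(1_B|A_n) > 1/2} approach B by Chebyshev's inequality. *)
Require Import Defs.
From mathcomp Require Import all_boot all_order all_algebra.
From mathcomp Require Import all_classical all_reals all_analysis.
From mathcomp Require Import measurable_realfun ring lra.

Set Implicit Arguments.
Unset Strict Implicit.
Unset Printing Implicit Defensive.

Import Order.TTheory GRing.Theory Num.Theory.
Import numFieldNormedType.Exports.

Local Open Scope classical_set_scope.
Local Open Scope ring_scope.

(** * Integrable real functions on a finite measure space *)

Lemma measurable_sg d (T : measurableType d) (R : realType) (g : T -> R) :
  measurable_fun [set: T] g -> measurable_fun [set: T] (fun x => Num.sg (g x)).
Proof.
apply: measurableT_comp; apply: nondecreasing_measurable => // x y xy.
by case: (sgrP x) => x0; case: (sgrP y) => y0; lra.
Qed.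

Section integrable_real.
Context d (T : measurableType d) (R : realType).
Variable mu : {finite_measure set T -> \bar R}.
Implicit Types (f g w : T -> R) (M c : R).

Definition L1 f := mu.-integrable [set: T] (EFin \o f).

Lemma L1_measurable f : L1 f -> measurable_fun [set: T] f.
Proof. by move=> /(measurable_int mu) /measurable_EFinP. Qed.

Lemma finite_measure_lty (B : set T) : measurable B -> (mu B < +oo)%E.
Proof. by move=> mB; rewrite -ge0_fin_numE//; exact: fin_num_measure. Qed.

Lemma L1_bounded f M : measurable_fun [set: T] f -> (forall x, `|f x| <= M) ->
  L1 f.
Proof.
move=> mf fM; apply: measurable_bounded_integrable => //.
  exact: finite_measure_lty.
exists M; split; first exact: num_real.
by move=> y My x _ /=; rewrite (le_trans (fM x))// ltW.
Qed.

Lemma L1_le f g : measurable_fun [set: T] f -> L1 g ->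
  (forall x, `|f x| <= g x) -> L1 f.
Proof.
move=> mf g1 fg; apply: (le_integrable _ _ _ g1) => //.
  exact/measurable_EFinP.
by move=> x _ /=; rewrite lee_fin (le_trans (fg x))// ler_norm.
Qed.

Lemma L1_cst c : L1 (fun=> c).
Proof. exact: (@L1_bounded _ `|c|). Qed.

Lemma L1D f g : L1 f -> L1 g -> L1 (fun x => f x + g x).
Proof. by move=> f1 g1; exact: (integrableD measurableT f1 g1). Qed.

Lemma L1B f g : L1 f -> L1 g -> L1 (fun x => f x - g x).
Proof. by move=> f1 g1; exact: (integrableB measurableT f1 g1). Qed.

Lemma L1Z c f : L1 f -> L1 (fun x => c * f x).
Proof. by move=> f1; exact: (integrableZl measurableT c f1). Qed.

Lemma L1_norm f : L1 f -> L1 (fun x => `|f x|).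
Proof. exact: integrable_norm. Qed.

Lemma L1M f w M : L1 f -> measurable_fun [set: T] w ->
  (forall x, `|w x| <= M) -> L1 (fun x => f x * w x).
Proof.
move=> f1 mw wM; apply: (@L1_le _ (fun x => M * `|f x|)).
- by apply: measurable_funM => //; exact: L1_measurable.
- exact/L1Z/L1_norm.
- by move=> x; rewrite normrM mulrC ler_wpM2r.
Qed.

Lemma normr_indic_le1 (B : set T) x : `|\1_B x : R| <= 1.
Proof. by rewrite indicE; case: (_ \in _); rewrite ?normr0 ?normr1. Qed.

Lemma L1_indic_sum (s : seq (R * set T)) :
  (forall p, p \in s -> measurable p.2) ->
  L1 (fun x => \sum_(p <- s) p.1 * \1_(p.2) x).
Proof.
elim: s => [|p s IH] ms; first by under eq_fun do rewrite big_nil; exact: L1_cst.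
under eq_fun do rewrite big_cons.
apply: L1D; last by apply: IH => q qs; apply: ms; rewrite inE qs orbT.
by apply/L1Z/integrable_indic/ms; rewrite inE eqxx.
Qed.

Lemma Rintegral_indic f (B : set T) : measurable B ->
  \int[mu]_x (f x * \1_B x) = \int[mu]_(x in B) f x.
Proof.
move=> mB; rewrite [RHS]Rintegral_mkcond; apply: eq_Rintegral => x _.
by rewrite /patch indicE; case: ifP => _; rewrite ?mulr1 ?mulr0.
Qed.

Lemma EFin_Rintegral f (B : set T) : measurable B -> L1 f ->
  (\int[mu]_(x in B) f x)%:E = (\int[mu]_(x in B) (f x)%:E)%E.
Proof.
move=> mB f1; rewrite /Rintegral fineK//; apply: integrable_fin_num => //.
exact: integrableS f1.
Qed.

Lemma ler_Rintegral f g : L1 f -> L1 g -> (forall x, f x <= g x) ->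
  \int[mu]_x f x <= \int[mu]_x g x.
Proof. by move=> f1 g1 fg; exact: le_Rintegral. Qed.

Lemma Rintegral_normM_le f w M : L1 f -> measurable_fun [set: T] w ->
  (forall x, `|w x| <= M) ->
  `|\int[mu]_x (f x * w x)| <= M * \int[mu]_x `|f x|.
Proof.
move=> f1 mw wM; have fw := L1M f1 mw wM.
rewrite (le_trans (le_normr_Rintegral _ fw))// -RintegralZl//; last exact: L1_norm.
apply: ler_Rintegral; [exact: L1_norm|exact/L1Z/L1_norm|move=> x].
by rewrite normrM mulrC ler_wpM2r.
Qed.

Lemma Rintegral_norm_triangle f g h : L1 f -> L1 g -> L1 h ->
  \int[mu]_x `|f x - h x| <= \int[mu]_x `|f x - g x| + \int[mu]_x `|g x - h x|.
Proof.
move=> f1 g1 h1; rewrite -RintegralD//; [|exact/L1_norm/L1B..].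
apply: ler_Rintegral; [exact/L1_norm/L1B|apply: L1D; exact/L1_norm/L1B|move=> x].
exact: ler_distD.
Qed.

End integrable_real.

(** * Measurability with respect to a family of sets, and simple functions *)

Section measurable_wrt.
Context d (T : measurableType d) (R : realType).
Implicit Types (D : set (set T)) (f g w : T -> R) (M e c : R).

(** Preimages are only required to lie in the sigma-algebra generated by [D]. Through
    [g_sigma_algebraType] the usual closure properties of measurable functions apply directly. *)
Definition measurable_wrt D g :=
  measurable_fun [set: g_sigma_algebraType D] (g : g_sigma_algebraType D -> R).

Lemma measurable_wrt_sub D D' g : D `<=` <<s D' >> -> measurable_wrt D g ->
  measurable_wrt D' g.
Proof.
move=> DD' mg _ B mB; have := mg measurableT B mB.
by rewrite !setTI; apply: smallest_sub => //; exact: smallest_sigma_algebra.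
Qed.

Lemma measurable_wrtW D g : D `<=` measurable -> measurable_wrt D g ->
  measurable_fun [set: T] g.
Proof.
move=> DM mg _ B mB; have := mg measurableT B mB.
rewrite !setTI; apply: smallest_sub => //; exact: sigma_algebra_measurable.
Qed.

Lemma measurable_wrt_indic D (B : set T) : D B -> measurable_wrt D (\1_B).
Proof.
move=> DB; apply: (@measurable_indic _ (g_sigma_algebraType D)).
exact: sub_sigma_algebra.
Qed.

Lemma measurable_wrt_preimage D g (B : set R) : sigma_algebra [set: T] D ->
  measurable_wrt D g -> measurable B -> D (g @^-1` B).
Proof.
move=> sD mg mB; have := mg measurableT B mB.
by rewrite setTI -[X in X -> _]/(<<s D >> (g @^-1` B)) sigma_algebra_id.
Qed.

(* The binary expansion of g/M: subtracting M 1_{g >= 0} - M/2 halves a bound M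
   on |g|. *)
Lemma indic_approximation D g M (n : nat) : sigma_algebra [set: T] D ->
  measurable_wrt D g -> (forall x, `|g x| <= M) ->
  exists s : seq (R * set T), (forall p, p \in s -> D p.2) /\
    forall x, `|g x - \sum_(p <- s) p.1 * \1_(p.2) x| <= M / 2 ^+ n.
Proof.
move=> sD; elim: n g M => [|n IH] g M mg gM.
  exists [::]; split=> // x.
  by rewrite big_nil subr0 expr0 divr1.
pose B := g @^-1` `[0, +oo[%classic.
have DB : D B by exact: measurable_wrt_preimage.
have DT : D setT.
  by have := measurable_wrt_preimage sD mg measurableT; rewrite preimage_setT.
have [||s [sD' sP]] := IH (fun x => g x - (M * \1_B x - M / 2)) (M / 2).
- apply: measurable_funB => //; apply: measurable_funB => //.
  by apply: measurable_funM => //; exact: measurable_wrt_indic.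
- move=> x; have := gM x; rewrite indicE ler_norml => /andP[g1 g2].
  have [|xB] := boolP (x \in B).
    by rewrite inE /B /= in_itv/= andbT => gx; rewrite ler_norml; apply/andP; split; lra.
  have {xB} : ~ B x by move: xB; rewrite notin_setE.
  rewrite /B /= in_itv/= andbT => /negP; rewrite -ltNge => gx.
  by rewrite ler_norml; apply/andP; split; lra.
exists [:: (M, B), (- (M / 2), setT) & s]; split.
  by move=> p; rewrite !inE => /orP[/eqP->//|/orP[/eqP->//|/sD']].
move=> x; rewrite !big_cons/= exprS invfM mulrA; apply: le_trans (sP x).
by rewrite le_eqVlt; apply/orP; left; apply/eqP; congr `|_|; rewrite indicT/=; ring.
Qed.

Lemma indic_approximation_eps D g M e : sigma_algebra [set: T] D ->
  measurable_wrt D g -> (forall x, `|g x| <= M) -> 0 < e ->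
  exists s : seq (R * set T), (forall p, p \in s -> D p.2) /\
    forall x, `|g x - \sum_(p <- s) p.1 * \1_(p.2) x| <= e.
Proof.
move=> sD mg gM e0.
(* The number [n] of halvings is the Archimedean bound of [M / e], for which [M / e < 2 ^+ n]. *)
have [s [sD' sP]] := indic_approximation (Num.bound (M / e)) sD mg gM.
exists s; split=> // x; apply: le_trans (sP x) _.
rewrite ler_pdivrMr ?exprn_gt0// -ler_pdivrMl// mulrC ltW//.
exact: upper_nthrootP.
Qed.

End measurable_wrt.

(** * Versions of the conditional expectation *)

Section version.
Context d (T : measurableType d) (R : realType).
Variable mu : {finite_measure set T -> \bar R}.
Implicit Types (D : set (set T)) (f g w : T -> R) (M e c : R).

(* Testing against bounded D-measurable weights, instead of sets of D, builds the
   pull-out property into the definition. *)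
Definition version D f g := [/\ measurable_wrt D g, L1 mu g &
  forall w (M : R), measurable_wrt D w -> (forall x, `|w x| <= M) ->
    \int[mu]_x (g x * w x) = \int[mu]_x (f x * w x)].

(** [is_cond_exp] does not demand integrability. It follows because the sets where [g] is
    nonnegative and negative lie in [D], so the integral of [g] over each of them is an integral of
    [f], hence finite. *)
Lemma is_cond_exp_L1 D f g : sigma_subalgebra D -> L1 mu f ->
  is_cond_exp mu D f g -> L1 mu g.
Proof.
move=> [sD DM] f1 [mg fg]; have mgT := measurable_wrtW DM mg.
pose B := g @^-1` `[0, +oo[%classic.
have DB : D B by exact: measurable_wrt_preimage.
have DB' : D (~` B) by have [_ /(_ _ DB)] := sD; rewrite setTD.
have fin E : D E -> (\int[mu]_(x in E) (g x)%:E)%E \is a fin_num.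
  move=> DE; rewrite -fg//; apply: integrable_fin_num; first exact: DM.
  by apply: integrableS f1 => //; exact: DM.
apply/integrableP; split; first exact/measurable_EFinP.
rewrite -(setUv B) ge0_integral_setU//=; [|exact: DM|exact: DM| |].
- rewrite lte_add_pinfty//.
  + rewrite (eq_integral (fun x => (g x)%:E)) ?ltey_eq ?fin//.
    move=> x; rewrite inE /B /= in_itv/= andbT => gx; by rewrite ger0_norm.
  + have H : (\int[mu]_(x in ~` B) (g x)%:E = - \int[mu]_(x in ~` B) `|g x|%:E)%E.
      rewrite -integral_ge0N//; apply: eq_integral => x; rewrite inE /B /= in_itv/= andbT.
      by move=> /negP; rewrite -ltNge => gx; rewrite ltr0_norm// opprK.
    by have := fin _ DB'; rewrite H fin_numN ltey_eq => ->.
- by rewrite setUv; apply/measurable_EFinP; exact: measurableT_comp.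
- by apply/disj_setPS; rewrite setICr.
Qed.

(** By linearity [h = g - f] integrates to zero against simple functions over [D]. These approximate
    a bounded weight uniformly, and [h] is integrable. *)
Lemma version_indic D f g : sigma_algebra [set: T] D -> D `<=` measurable ->
    measurable_wrt D g -> L1 mu f -> L1 mu g ->
    (forall B, D B -> \int[mu]_x (g x * \1_B x) = \int[mu]_x (f x * \1_B x)) ->
  version D f g.
Proof.
move=> sD DM mg f1 g1 fg; split=> // w M mw wM.
have mwT := measurable_wrtW DM mw.
pose h x := g x - f x; have h1 : L1 mu h := L1B g1 f1.
suff : \int[mu]_x (h x * w x) = 0.
  rewrite (@eq_Rintegral _ _ _ _ _ (fun x => g x * w x - f x * w x)).
    by rewrite RintegralB//; [move/eqP; rewrite subr_eq0 => /eqP|exact: L1M wM..].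
  by move=> x _; rewrite mulrBl.
have mB (p : R * set T) : D p.2 -> L1 mu (fun x => h x * (p.1 * \1_p.2 x)).
  move=> /DM mp; apply: (@L1M _ _ _ _ _ _ `|p.1|) => //.
    by apply: measurable_funM => //; exact: measurable_indic.
  by move=> x; rewrite normrM ler_piMr// normr_indic_le1.
have sum0 (s : seq (R * set T)) : (forall p, p \in s -> D p.2) ->
   L1 mu (fun x => h x * \sum_(p <- s) p.1 * \1_(p.2) x) /\
   \int[mu]_x (h x * \sum_(p <- s) p.1 * \1_(p.2) x) = 0.
  elim: s => [|p s IH] sD'.
    have E : (fun x => h x * \sum_(p <- [::]) p.1 * \1_(p.2) x) = (fun=> 0).
      by apply/funext => x; rewrite big_nil mulr0.
    by rewrite E; split; [exact: L1_cst|rewrite Rintegral_cst// mul0r].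
  have [|i1 i2] := IH; first by move=> q qs; apply: sD'; rewrite inE qs orbT.
  have Dp : D p.2 by apply: sD'; rewrite inE eqxx.
  have E : (fun x => h x * \sum_(q <- (p :: s)) q.1 * \1_(q.2) x) =
      (fun x => h x * (p.1 * \1_p.2 x) + h x * \sum_(q <- s) q.1 * \1_(q.2) x).
    by apply/funext => x; rewrite big_cons mulrDr.
  have i3 := mB _ Dp.
  rewrite E; split; first exact: L1D.
  rewrite RintegralD// i2 addr0.
  under eq_Rintegral do rewrite mulrCA.
  have i4 k : L1 mu k -> L1 mu (fun x => k x * \1_p.2 x).
    move=> k1; apply: (@L1M _ _ _ _ _ _ 1) => //.
      by apply: measurable_indic; exact: DM.
    by move=> x; exact: normr_indic_le1.
  rewrite RintegralZl//; last exact: i4.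
  under eq_Rintegral do rewrite mulrBl.
  by rewrite RintegralB ?fg ?subrr ?mulr0//; exact: i4.
have I0 : 0 <= \int[mu]_x `|h x| by exact: Rintegral_ge0.
apply/eqP; rewrite -normr_le0; apply/ler_addgt0Pr => e e0; rewrite add0r.
(* The summand 1 keeps the denominator positive when the integral vanishes; the same device recurs
   below. *)
have e'0 : 0 < e / (\int[mu]_x `|h x| + 1) by rewrite divr_gt0// ltr_wpDl.
have [s [/sum0[s1 s0] sP]] := indic_approximation_eps sD mw wM e'0.
have hw1 := L1M h1 mwT wM.
rewrite -[X in `|X|]subr0 -s0 -RintegralB//.
rewrite (@eq_Rintegral _ _ _ _ _
  (fun x => h x * (w x - \sum_(p <- s) p.1 * \1_(p.2) x))); last first.
  by move=> x _; rewrite mulrBr.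
have hs1 : L1 mu (fun x => h x * (w x - \sum_(p <- s) p.1 * \1_(p.2) x)).
  have := L1B hw1 s1; congr (L1 _ _); apply/funext => x; by rewrite mulrBr.
rewrite (le_trans (le_normr_Rintegral _ hs1))//.
apply: (@le_trans _ _ (\int[mu]_x ((e / (\int[mu]_x `|h x| + 1)) * `|h x|))).
  apply: ler_Rintegral; [exact: L1_norm|exact/L1Z/L1_norm|move=> x].
  by rewrite normrM mulrC ler_wpM2r.
rewrite RintegralZl//; last exact: L1_norm.
by rewrite mulrAC ler_pdivrMr ?ltr_wpDl// ler_pM2l// lerDl.
Qed.

Lemma is_cond_exp_version D f g : sigma_subalgebra D -> L1 mu f ->
  is_cond_exp mu D f g -> version D f g.
Proof.
move=> sDM f1 fg; have g1 := is_cond_exp_L1 sDM f1 fg.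
case: sDM => sD DM; case: fg => mg fg; apply: version_indic => // B DB.
by rewrite !Rintegral_indic; [rewrite /Rintegral fg|exact: DM..].
Qed.

Lemma cond_exp_version D f : sigma_subalgebra D -> L1 mu f ->
  version D f (cond_exp mu D f).
Proof. by move=> sD f1; apply: is_cond_exp_version => //; exact: cond_expP. Qed.

Lemma version_id D f : L1 mu f -> measurable_wrt D f -> version D f f.
Proof. by move=> f1 mf; split. Qed.

Lemma versionB D f1 f2 g1 g2 : D `<=` measurable -> L1 mu f1 -> L1 mu f2 ->
  version D f1 g1 -> version D f2 g2 ->
  version D (fun x => f1 x - f2 x) (fun x => g1 x - g2 x).
Proof.
move=> DM i1 i2 [mg1 ig1 fg1] [mg2 ig2 fg2]; split.
- exact: measurable_funB.
- exact: L1B.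
move=> w M mw wM; have mwT := measurable_wrtW DM mw.
under eq_Rintegral do rewrite mulrBl.
under [RHS]eq_Rintegral do rewrite mulrBl.
rewrite !RintegralB//; try exact: L1M wM.
by rewrite (fg1 _ _ mw wM) (fg2 _ _ mw wM).
Qed.

(** A weight for [D] is also a weight for [D'], so both sides equal its integral against [f]. *)
Lemma version_tower D D' f g g' : D `<=` <<s D' >> ->
  version D f g -> version D' f g' -> version D g' g.
Proof.
move=> DD' [mg g1 fg] [mg' g'1 fg']; split=> // w M mw wM.
by rewrite (fg _ _ mw wM) (fg' w M)//; exact: measurable_wrt_sub mw.
Qed.

(** The sign of [g] is an admissible weight, and [|g|] is [g] times its sign. *)
Lemma version_contraction D f g : D `<=` measurable -> L1 mu f ->
  version D f g -> \int[mu]_x `|g x| <= \int[mu]_x `|f x|.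
Proof.
move=> DM f1 [mg g1 fg].
pose s x := Num.sg (g x).
have ms : measurable_wrt D s by exact: measurable_sg.
have s1 x : `|s x| <= 1 by rewrite normr_sg; case: (_ != _).
have msT := measurable_wrtW DM ms.
have -> : \int[mu]_x `|g x| = \int[mu]_x (f x * s x).
  by rewrite -(fg _ _ ms s1); apply: eq_Rintegral => x _; rewrite normrEsg mulrC.
apply: (le_trans (ler_norm _)).
by rewrite (le_trans (Rintegral_normM_le f1 msT s1))// mul1r.
Qed.

End version.

(** * Upper limits of real sequences, and a geometric sum *)

Section limsup.
Context (R : realType).
Implicit Type u : R^nat.

(** Total and real-valued: [fine] sends an infinite upper limit to 0. This is harmless for the
    bounded sequences considered here. *)
Definition limsup u : R := fine (limn_esup (EFin \o u)).

(** Carries eventual pointwise bounds over to the upper limit without any convergence of the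
    sequence. *)
Lemma limsup_itv u (a b : R) k : (forall i, (k <= i)%N -> a <= u i <= b) ->
  a <= limsup u <= b.
Proof.
move=> uab; set v := EFin \o u.
have v1 n : (k <= n)%N -> (esups v n <= b%:E)%E.
  move=> kn; apply: ge_ereal_sup => _ [i /= ni <-]; rewrite lee_fin.
  by have /andP[] := uab _ (leq_trans kn ni).
have v2 n : (k <= n)%N -> (a%:E <= esups v n)%E.
  move=> kn; apply: (@le_trans _ _ (v n)).
    by rewrite lee_fin; have /andP[] := uab _ kn.
  by apply: ereal_sup_ubound; exists n => /=.
have cv := @is_cvg_esups _ v.
have l1 : (limn_esup v <= b%:E)%E.
  by rewrite limn_esup_lim; apply: lime_le => //; exists k.
have l2 : (a%:E <= limn_esup v)%E.
  by rewrite limn_esup_lim; apply: lime_ge => //; exists k.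
rewrite /limsup -/v; move: l1 l2; case: (limn_esup v) => [r| |]//.
by rewrite !lee_fin /= => -> ->.
Qed.

(** The upper limit depends only on the tail. This makes the limit of a reverse martingale
    measurable for every sigma-algebra of the decreasing sequence. *)
Lemma limsup_shift u m : limsup (fun n => u (n + m)%N) = limsup u.
Proof.
rewrite /limsup !limn_esup_lim; congr fine.
have -> : esups (EFin \o (fun n => u (n + m)%N)) =
    fun n => esups (EFin \o u) (n + m).
  apply/funext => n; congr ereal_sup; apply/seteqP; split => _ [i /= ni <-].
    by exists (i + m)%N => //=; rewrite leq_add2r.
  exists (i - m)%N => /=; first by rewrite leq_subRL ?(leq_trans _ ni) ?leq_addl// addnC.
  by rewrite subnK// (leq_trans _ ni)// leq_addl.
apply/cvg_lim => //.
have := @is_cvg_esups _ (EFin \o u).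
by rewrite -(cvg_shiftn m).
Qed.

Lemma measurable_limsup d (Y : measurableType d) (u : (Y -> R)^nat) :
  (forall n, measurable_fun [set: Y] (u n)) ->
  measurable_fun [set: Y] (fun x => limsup (u^~ x)).
Proof.
move=> mu; apply: (measurableT_comp (fine_measurable measurableT)).
by apply: measurable_fun_limn_esup => n; exact/measurable_EFinP.
Qed.

End limsup.

Section geometric.
Context (R : realType).

Lemma geometric_tail (k n : nat) :
  \sum_(0 <= j < n) (2 ^- (k + j) : R) <= 2 * 2 ^- k.
Proof.
(* The exact value of the sum, which is what the induction can carry. *)
apply: (@le_trans _ _ (2 * 2 ^- k - 2 * 2 ^- (k + n))).
  elim: n => [|n IH]; first by rewrite addn0 subrr big_geq.
  rewrite addnS big_nat_recr//= exprS invfM.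
  set c := 2 ^- (k + n) in IH *; by move: IH; lra.
by rewrite gerBl mulr_ge0.
Qed.

End geometric.

(** * Everywhere bounded versions *)

Section bounded_version.
Context d (T : measurableType d) (R : realType).
Variable mu : {finite_measure set T -> \bar R}.
Implicit Types (D : set (set T)) (f g w : T -> R) (M e c : R).

(** Against a weight bounded by [M], the integral of [g - h] is at most [M] times the L^1 distance
    of [g] and [h], which is zero. *)
Lemma version_eq D f g h : D `<=` measurable -> version mu D f g ->
  measurable_wrt D h -> L1 mu h -> \int[mu]_x `|g x - h x| <= 0 ->
  version mu D f h.
Proof.
move=> DM [mg g1 fg] mh h1 gh; split=> // w M mw wM.
have mwT := measurable_wrtW DM mw.
rewrite -(fg _ _ mw wM); apply/eqP; rewrite eq_sym -subr_eq0 -normr_le0.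
rewrite -RintegralB//; [|exact: L1M wM..].
under eq_Rintegral do rewrite -mulrBl.
have g'h := L1B g1 h1.
apply: (le_trans (Rintegral_normM_le g'h mwT wM)).
have [M0|M0] := leP 0 M; first by rewrite mulr_ge0_le0.
rewrite (_ : \int[mu]_x _ = 0) ?mulr0//.
by apply/eqP; rewrite eq_le gh Rintegral_ge0.
Qed.

(** The chosen version need not satisfy the bound at every point, so it is clamped to [[- M, M]]. A
    bound at every point is needed later to use versions as weights and to bound their upper
    limit. *)
Lemma bounded_version D f M : sigma_subalgebra D -> measurable_fun [set: T] f ->
  0 <= M -> (forall x, `|f x| <= M) ->
  exists2 h, version mu D f h & forall x, `|h x| <= M.
Proof.
move=> sDM mf M0 fM; have f1 := L1_bounded mu mf fM.
have NM : - M <= M by lra.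
have fg := cond_exp_version sDM f1.
set g := cond_exp mu D f in fg.
have [mg g1 fgw] := fg; have [sD DM] := sDM.
pose h x := Num.max (- M) (Num.min (g x) M).
have hM x : `|h x| <= M.
  by rewrite /h ler_norml le_max lexx/= ge_max ge_min lexx orbT NM.
have mh : measurable_wrt D h.
  by apply: measurable_maxr => //; exact: measurable_minr.
have mhT := measurable_wrtW DM mh.
exists h => //; apply: (version_eq DM fg mh (L1_bounded mu mhT hM)).
pose w x := Num.sg (g x - h x).
have mw : measurable_wrt D w by apply/measurable_sg; exact: measurable_funB.
have mwT := measurable_wrtW DM mw.
have w1 x : `|w x| <= 1 by rewrite normr_sg; case: (_ != _).
have gw := L1M g1 mwT w1; have fw := L1M f1 mwT w1.
have Mw : L1 mu (fun x => M * `|w x|).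
  apply/L1Z; apply: (@L1_bounded _ _ _ _ _ 1); first exact: measurableT_comp.
  by move=> x; rewrite normr_id.
(* Where [w] is 1 or -1, the clamped value [h] is [M] or [- M], hence [|g - h| = g w - M |w|]. The
   weight [w] allows [g] to be replaced by [f], and [f w <= M |w|]. *)
rewrite (@eq_Rintegral _ _ _ _ _ (fun x => g x * w x - M * `|w x|)); last first.
  move=> x _; rewrite /w normrEsg mulrC mulrBl; congr (_ - _).
  rewrite /h; case: (ltgtP (g x) M) => [gx|gx|gx].
  - case: (ltP (- M) (g x)) => gx'; first by rewrite subrr sgr0 normr0 !mulr0.
    have [->|gxN] := eqVneq (g x) (- M); first by rewrite subrr sgr0 normr0 !mulr0.
    have {}gx' : g x < - M by rewrite lt_neqAle gxN.
    by rewrite ltr0_sg ?subr_lt0// normrN1; ring.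
  - rewrite max_r // gtr0_sg ?normr1// subr_gt0//.
  - by rewrite gx max_r // subrr sgr0 normr0 !mulr0.
rewrite RintegralB// (fgw _ _ mw w1) -RintegralB//.
rewrite -[leRHS](mul0r (fine (mu setT))) -(Rintegral_cst mu measurableT 0).
apply: ler_Rintegral; [exact: L1B|exact: L1_cst|move=> x].
rewrite subr_le0 (le_trans (ler_norm _))// normrM ler_wpM2r//.
Qed.

End bounded_version.

(** * Reverse martingales *)

Section reverse_martingale.
Context d (T : measurableType d) (R : realType).
Variable mu : {finite_measure set T -> \bar R}.
Variables (B : (set (set T))^nat) (f : T -> R) (M : R) (h : (T -> R)^nat).
Hypothesis sB : forall m, sigma_subalgebra (B m).
Hypothesis dB : forall m n, (m <= n)%N -> B n `<=` B m.
Hypothesis hM : forall m x, `|h m x| <= M.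
Hypothesis fh : forall m, version mu (B m) f (h m).

Let BM m : B m `<=` measurable. Proof. by case: (sB m). Qed.

Let mhT m : measurable_fun [set: T] (h m).
Proof. by have [/(measurable_wrtW (@BM m))] := fh m. Qed.

Let h1 m : L1 mu (h m). Proof. by have [] := fh m. Qed.

Let hh1 m n : L1 mu (fun x => h m x * h n x).
Proof. exact: L1M (hM n). Qed.

(** Orthogonality: by the tower property [h n] is a version for [h m], and using [h n] itself as
    weight turns the cross term into the energy of [h n]. *)
Let sqr_energy m n : (m <= n)%N ->
  \int[mu]_x (h m x - h n x) ^+ 2 =
  \int[mu]_x (h m x * h m x) - \int[mu]_x (h n x * h n x).
Proof.
move=> mn.
have [mh _ _] := fh n.
have [_ _ t] : version mu (B n) (h m) (h n).
  apply: version_tower (fh n) (fh m); apply: subset_trans (dB mn) _.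
  exact: sub_sigma_algebra.
rewrite (@eq_Rintegral _ _ _ _ _ (fun x =>
  h m x * h m x + (h n x * h n x - 2 * (h m x * h n x)))); last first.
  by move=> x _; ring.
rewrite RintegralD//; [|exact: hh1|by apply: L1B; [exact: hh1|exact/L1Z/hh1]].
rewrite RintegralB//; [|exact: hh1|exact/L1Z/hh1].
rewrite RintegralZl//; last exact: hh1.
by rewrite -(t _ _ mh (hM n)); ring.
Qed.

(** The energies are nonincreasing, since their differences are integrals of squares, and bounded
    below by 0. Past an index within [e] of the infimum they vary by at most [e]. *)
Let energy_cauchy (e : R) : 0 < e -> exists N, forall m n, (N <= m)%N -> (m <= n)%N ->
  \int[mu]_x (h m x - h n x) ^+ 2 <= e.
Proof.
move=> e0; pose a m := \int[mu]_x (h m x * h m x).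
have a0 m : 0 <= a m by apply: Rintegral_ge0 => x _; rewrite -expr2 sqr_ge0.
have da : nonincreasing_seq a.
  move=> m n mn; rewrite -subr_ge0 -sqr_energy//.
  by apply: Rintegral_ge0 => x _; exact: sqr_ge0.
have [|_ [N _ <-] aN] := @inf_adherent _ (range a) _ e0.
  by split; [exists (a 0); exists 0|exists 0 => _ [m _ <-]].
exists N => m n Nm mn; rewrite sqr_energy// lerBlDr.
have := da _ _ Nm; have : inf (range a) <= a n.
  by apply: ge_inf; [exists 0 => _ [i _ <-]|exists n].
by rewrite -/(a m) -/(a n); move: aN; lra.
Qed.

Let L1_cauchy (e : R) : 0 < e -> exists N, forall m n, (N <= m)%N -> (N <= n)%N ->
  \int[mu]_x `|h m x - h n x| <= e.
Proof.
move=> e0; set V := fine (mu setT).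
have V0 : 0 <= V by exact: fine_ge0.
(* Chosen so that [t * V <= e], while an energy difference of at most [e * t] becomes at most [e]
   after division by [t]. The estimate below takes half the sum of these two terms. *)
pose t := e / (V + 1); have t0 : 0 < t by rewrite divr_gt0// ltr_wpDl.
have [N NP] := energy_cauchy (mulr_gt0 e0 t0).
have H m n : (N <= m)%N -> (m <= n)%N -> \int[mu]_x `|h m x - h n x| <= e.
  move=> Nm mn; have d1 := L1B (h1 m) (h1 n).
  have d2 : L1 mu (fun x => (h m x - h n x) ^+ 2).
    apply: (@L1M _ _ _ _ _ (fun x => h m x - h n x) (2 * M)) => //.
      exact: measurable_funB.
    by move=> x; rewrite (le_trans (ler_normB _ _))// mulr_natl mulr2n lerD.
  (* AM-GM: |y| <= (t + y^2/t)/2 *)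
  apply: (@le_trans _ _ (\int[mu]_x (2^-1 * (t + t^-1 * (h m x - h n x) ^+ 2)))).
    apply: ler_Rintegral; [exact: L1_norm| |move=> x].
      by apply: L1Z; apply: L1D; [exact: L1_cst|exact: L1Z].
    set y := h m x - h n x.
    rewrite ler_pdivlMl// -(ler_pM2l t0) mulrDr mulVKf ?gt_eqF// -subr_ge0.
    rewrite -(real_normK (num_real y)) [X in 0 <= X](_ : _ = (t - `|y|) ^+ 2).
      exact: sqr_ge0.
    by ring.
  rewrite RintegralZl//; last by apply: L1D; [exact: L1_cst|exact: L1Z].
  rewrite RintegralD//; [|exact: L1_cst|exact: L1Z].
  rewrite Rintegral_cst// RintegralZl// -/V.
  have k1 : t * V <= e.
    by rewrite /t mulrAC ler_pdivrMr ?ltr_wpDl// ler_pM2l// lerDl.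
  have : t^-1 * \int[mu]_x (h m x - h n x) ^+ 2 <= e.
    by rewrite ler_pdivrMl// mulrC; exact: NP.
  by lra.
exists N => m n Nm Nn; have [mn|/ltnW nm] := leqP m n; first exact: H.
rewrite (@eq_Rintegral _ _ _ _ _ (fun x => `|h n x - h m x|)); first exact: H.
by move=> x _; exact: distrC.
Qed.

Lemma reverse_martingale_L1_cvg : exists g, [/\ version mu (\bigcap_m B m) f g,
  forall x, `|g x| <= M &
  forall e : R, 0 < e -> exists N, forall m, (N <= m)%N ->
    \int[mu]_x `|h m x - g x| <= e].
Proof.
have [N NP] := choice (fun k => @L1_cauchy (2 ^- k) ltac:(by rewrite invr_gt0 exprn_gt0)).
(* A nondecreasing sequence of indices that dominates both [k] and [N k]. *)
pose p k := (k + \sum_(i < k.+1) N i)%N.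
have kp k : (k <= p k)%N by exact: leq_addr.
have Np k : (N k <= p k)%N.
  by rewrite /p big_ord_recr/= addnA leq_addl.
have dp k : (p k <= p k.+1)%N.
  by rewrite /p addSn leqW// leq_add2l [leqRHS]big_ord_recr leq_addr.
have pN k i : (k <= i)%N -> (N k <= p i)%N.
  move=> ki; apply: (leq_trans (Np k)).
  by apply: (homo_leq (@leqnn) leq_trans) ki.
pose u k := h (p k).
pose D j x := `|u j.+1 x - u j x|.
have D1 j : L1 mu (D j) by apply/L1_norm/L1B; exact: h1.
have ID j : \int[mu]_x D j x <= 2 ^- j.
  by apply: NP; apply: pN.
(* The total variation of the subsequence from [k] on. By monotone convergence its integral is at
   most [2 * 2 ^- k]. *)
pose S k x := (\sum_(j <oo) (D (k + j)%N x)%:E)%E.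
have uS k n x : (`|u (k + n)%N x - u k x|%:E <= S k x)%E.
  apply: (@le_trans _ _ (\sum_(0 <= j < n) (D (k + j)%N x)%:E)%E); last first.
    by apply: nneseries_lim_ge => j _ _; rewrite lee_fin normr_ge0.
  rewrite sumEFin lee_fin; elim: n => [|n IH].
    by rewrite addn0 subrr normr0 big_geq.
  rewrite big_nat_recr//= addnS addrC (le_trans (ler_distD (u (k + n)%N x) _ _))//.
  by rewrite lerD.
pose g x := limsup (u^~ x).
have gM x : `|g x| <= M.
  rewrite ler_norml; apply: (@limsup_itv _ _ _ _ 0) => i _.
  by rewrite -ler_norml; exact: hM.
(* The bound by the (possibly infinite) tail S k holds at every point, so the
   almost everywhere convergence of u is not needed. *)
have gS k x : (`|u k x - g x|%:E <= S k x)%E.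
  have : (0 <= S k x)%E by apply: nneseries_ge0 => j _ _; rewrite lee_fin normr_ge0.
  case SE : (S k x) => [r| |] // _; last by rewrite leey.
  rewrite lee_fin distrC ler_distl.
  apply: (@limsup_itv _ _ _ _ k) => i /subnKC <-.
  by rewrite -ler_distl -lee_fin -SE; exact: uS.
have mg m : measurable_wrt (B m) g.
  (* After dropping [m] terms every remaining index is at least [m], so all the functions are
     measurable for [B m]. *)
  rewrite /measurable_wrt (_ : g = fun x => limsup (fun n => u (n + m)%N x)).
    apply: (@measurable_limsup _ _ (g_sigma_algebraType (B m))) => n.
    have [+ _ _] := fh (p (n + m)); apply: measurable_wrt_sub.
    apply: subset_trans (@sub_sigma_algebra _ _ _); apply: dB.
    by rewrite (leq_trans _ (kp _))// leq_addl.
  by apply/funext => y; rewrite (limsup_shift (u^~ y) m).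
have mgT : measurable_fun [set: T] g := measurable_wrtW (@BM 0) (mg 0).
have g1 : L1 mu g := L1_bounded mu mgT gM.
have Iug k : \int[mu]_x `|u k x - g x| <= 2 * 2 ^- k.
  rewrite -lee_fin EFin_Rintegral//; last by apply/L1_norm/L1B => //; exact: h1.
  apply: (@le_trans _ _ (\int[mu]_x S k x)%E).
    apply: ge0_le_integral => //.
    - by apply/measurable_EFinP/measurableT_comp => //; apply: measurable_funB => //; exact: mhT.

    - apply: ge0_emeasurable_sum => [j x _ _|j _].
        by rewrite lee_fin normr_ge0.
      by apply/measurable_EFinP; exact: L1_measurable (D1 _).
  rewrite integral_nneseries//; last first.
  - by move=> j x _; rewrite lee_fin normr_ge0.
  - by move=> j; apply/measurable_EFinP; exact: L1_measurable (D1 _).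
  apply: lime_le.
    by apply: is_cvg_nneseries => j _ _; apply: integral_ge0 => x _; rewrite lee_fin normr_ge0.
  apply: nearW => n.
  rewrite (eq_bigr (fun j => (\int[mu]_x D (k + j)%N x)%:E)); last first.
    by move=> j _; rewrite EFin_Rintegral.
  rewrite sumEFin lee_fin; apply: le_trans (geometric_tail _ k n).
  by apply: ler_sum => j _; exact: ID.
have hg (e : R) : 0 < e -> exists N, forall m, (N <= m)%N -> \int[mu]_x `|h m x - g x| <= e.
  (* One [2 ^- k] pays for the distance from [h m] to [h (p k)], and two for that from [h (p k)] to
     [g]. *)
  move=> e0; pose k := Num.bound (3 / e).
  have ke : 3 * 2 ^- k <= e.
    rewrite ler_pdivrMr ?exprn_gt0// -ler_pdivrMl// mulrC ltW//.
    exact: upper_nthrootP.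
  exists (p k) => m pm.
  apply: (le_trans (Rintegral_norm_triangle (h1 m) (h1 (p k)) g1)).
  have := NP k m (p k) (leq_trans (Np k) pm) (Np k).
  have := Iug k; rewrite /u; move: ke; set c := 2 ^- k => ke i1 i2.
  by apply: le_trans ke; lra.
exists g; split=> //; split=> //.
  move=> _ Y mY; rewrite setTI; apply: sub_sigma_algebra => m _.
  by apply: measurable_wrt_preimage (mg m) mY; case: (sB m).
move=> w C mw wC.
have mwB m : measurable_wrt (B m) w.
  apply: measurable_wrt_sub mw => E /(_ m I) BE; exact: sub_sigma_algebra.
have mwT := measurable_wrtW (@BM 0) (mwB 0).
apply/eqP; rewrite eq_sym -subr_eq0 -normr_le0; apply/ler_addgt0Pr => e e0; rewrite add0r.
have [m /(_ m (leqnn m)) me] := hg (e / (`|C| + 1)) ltac:(by rewrite divr_gt0// ltr_wpDl).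
have [_ _ t] := fh m.
rewrite -(t _ _ (mwB m) wC) -RintegralB//; [|exact: L1M wC..].
under eq_Rintegral do rewrite -mulrBl.
have wC' x : `|w x| <= `|C| + 1.
  by rewrite (le_trans (wC x))// (le_trans (ler_norm _))// lerDl.
apply: (le_trans (Rintegral_normM_le (L1B (h1 m) g1) mwT wC')).
by rewrite mulrC -ler_pdivlMr// ltr_wpDl.
Qed.

End reverse_martingale.

(** * Approximation by the sigma-algebras A_n *)

Section upper_limit.
Context d (T : measurableType d) (R : realType).
Variable mu : {finite_measure set T -> \bar R}.
Variable A : (set (set T))^nat.
Implicit Types (D : set (set T)) (f g : T -> R) (M e : R).
Hypothesis A_sub : forall n, sigma_subalgebra (A n).

Lemma sigma_join_sub m : sigma_subalgebra (sigma_join A m).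
Proof.
split; first exact: smallest_sigma_algebra.
apply: smallest_sub; first exact: sigma_algebra_measurable.
by move=> B [n _ AB]; have [_] := A_sub n; apply.
Qed.

Lemma sub_sigma_join n : A n `<=` sigma_join A n.
Proof. by move=> B AB; apply: sub_sigma_algebra; exists n => /=. Qed.

Lemma sigma_join_le m n : (m <= n)%N -> sigma_join A n `<=` sigma_join A m.
Proof.
move=> mn; apply: sub_sigma_algebra2 => B [k /= nk AB].
by exists k => //=; exact: leq_trans nk.
Qed.

Lemma upper_limit_sub : sigma_subalgebra (upper_limit A).
Proof.
split; last by move=> B /(_ 0 I); have [_] := sigma_join_sub 0; apply.
have H m := (sigma_join_sub m).1.
split.
- by move=> m _; have [+ _ _] := H m.
- by move=> B AB m _; have [_ + _] := H m; apply; exact: AB.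
- by move=> F FB m _; have [_ _] := H m; apply => i; exact: FB.
Qed.

(** Each set [E] of the simple function is replaced by its approximating sets [C n]; the L^1
    distance of the two indicators is the measure of the symmetric difference. *)
Lemma approaches_indic_sum D (s : seq (R * set T)) :
    D `<=` measurable -> approaches_in_measure mu A D ->
    (forall p, p \in s -> D p.2) ->
  exists h : (T -> R)^nat, (forall n, measurable_wrt (A n) (h n) /\ L1 mu (h n)) /\
    forall e : R, 0 < e -> exists N, forall n, (N <= n)%N ->
      \int[mu]_x `|h n x - \sum_(p <- s) p.1 * \1_(p.2) x| <= e.
Proof.
move=> DM AD; elim: s => [|[c E] s IH] sD.
  exists (fun _ _ => 0); split.
    by move=> n; split; [exact: measurable_cst|exact: L1_cst].
  move=> e e0; exists 0 => n _.
  under eq_Rintegral do rewrite big_nil subrr normr0.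
  by rewrite Rintegral_cst// mul0r ltW.
have [|h [hm he]] := IH; first by move=> p ps; apply: sD; rewrite inE ps orbT.
have DE : D E by apply: (sD (c, E)); rewrite inE eqxx.
have mE := DM _ DE.
have [C [CA CE]] := AD _ DE.
have AM n : A n `<=` measurable by have [] := A_sub n.
have mC n : measurable (C n) by exact: AM.
have i1 (B : set T) : measurable B -> L1 mu (fun x => c * \1_B x).
  by move=> mB; apply: L1Z; exact: integrable_indic.
exists (fun n x => c * \1_(C n) x + h n x); split.
  move=> n; have [h1 h2] := hm n; split; last by apply: L1D => //; exact: i1.
  apply: measurable_funD => //; apply: measurable_funM => //.
  exact: measurable_wrt_indic.
have i2 : L1 mu (fun x => \sum_(p <- s) p.1 * \1_p.2 x).
  by apply: L1_indic_sum => p ps; apply/DM/sD; rewrite inE ps orbT.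
move=> e e0.
have [N NP] := he (e / 2) (divr_gt0 e0 (ltr0n _ 2)).
have e'0 : 0 < e / 2 / (`|c| + 1) by rewrite !divr_gt0// ltr_wpDl.
have /fine_cvgP[_ /cvgr0Pnorm_le /(_ _ e'0) [N' _ N'P]] := CE.
exists (maxn N N') => n; rewrite geq_max => /andP[/NP n1 /N'P /= n2].
have [_ hn1] := hm n.
have mCE : measurable (C n `+` E) by rewrite setY_def; apply: measurableU; exact: measurableD.
apply: (@le_trans _ _ (\int[mu]_x (`|c| * \1_(C n `+` E) x +
    `|h n x - \sum_(p <- s) p.1 * \1_p.2 x|))).
  have i3 : L1 mu (fun x => `|c| * \1_(C n `+` E) x).
    by apply: L1Z; exact: integrable_indic.
  apply: ler_Rintegral; [|by apply: L1D => //; exact/L1_norm/L1B|move=> x].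
    apply: L1_norm; apply: L1B; first by apply: L1D => //; exact: i1.
    under eq_fun do rewrite big_cons.
    by apply: L1D => //; exact: i1.
  rewrite big_cons/= opprD addrACA -mulrBr (le_trans (ler_normD _ _))// lerD2r.
  rewrite normrM ler_wpM2l// !indicE setY_def in_setU !in_setD.
  by case: (x \in C n); case: (x \in E); rewrite /= ?subrr ?subr0 ?sub0r ?normrN ?normr0 ?normr1.
rewrite RintegralD//; [|by apply: L1Z; exact: integrable_indic|exact/L1_norm/L1B].
rewrite RintegralZl//; last exact: integrable_indic.
have -> : \int[mu]_x \1_(C n `+` E) x = fine (mu (C n `+` E)).
  by rewrite /Rintegral integral_indic// setIT.
rewrite (splitr e) lerD//.
move: n2; rewrite ger0_norm ?fine_ge0// ler_pdivlMr ?ltr_wpDl// mulrC => n2.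
by apply: le_trans n2; rewrite ler_wpM2r ?fine_ge0// lerDl.
Qed.

(** Half of [e] goes to a uniform approximation of [g] by a simple function over [D], half to the
    approximation of that function. The sequence [h] may depend on [e]. *)
Lemma approaches_bounded D g M e :
    sigma_subalgebra D -> approaches_in_measure mu A D ->
    measurable_wrt D g -> (forall x, `|g x| <= M) -> 0 < e ->
  exists h : (T -> R)^nat, (forall n, measurable_wrt (A n) (h n) /\ L1 mu (h n)) /\
    exists N, forall n, (N <= n)%N -> \int[mu]_x `|h n x - g x| <= e.
Proof.
move=> [sD DM] AD mg gM e0; set V := fine (mu setT).
have V0 : 0 <= V by exact: fine_ge0.
have e'0 : 0 < e / 2 / (V + 1) by rewrite !divr_gt0// ltr_wpDl.
have [s [sD' sP]] := indic_approximation_eps sD mg gM e'0.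
have [h [hm he]] := approaches_indic_sum DM AD sD'.
exists h; split=> //.
have [N NP] := he (e / 2) (divr_gt0 e0 (ltr0n _ 2)).
exists N => n /NP {}NP.
have g1 : L1 mu g := L1_bounded mu (measurable_wrtW DM mg) gM.
have s1 : L1 mu (fun x => \sum_(p <- s) p.1 * \1_p.2 x).
  by apply: L1_indic_sum => p /sD' /DM.
have [_ h1] := hm n.
apply: (le_trans (Rintegral_norm_triangle h1 s1 g1)).
rewrite (splitr e) lerD//.
apply: (@le_trans _ _ (\int[mu]_x (e / 2 / (V + 1)))).
  apply: ler_Rintegral; [exact/L1_norm/L1B|exact: L1_cst|move=> x].
  by rewrite distrC.
by rewrite Rintegral_cst// -/V mulrAC ler_pdivrMr ?ltr_wpDl// ler_pM2l ?divr_gt0// lerDl.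
Qed.

Lemma bounded_version_L1_cvg f M (h : (T -> R)^nat) :
    approaches_in_measure mu A (upper_limit A) ->
    measurable_fun [set: T] f -> 0 <= M -> (forall x, `|f x| <= M) ->
    (forall n, version mu (A n) f (h n)) ->
  exists g, [/\ version mu (upper_limit A) f g, forall x, `|g x| <= M &
    forall e : R, 0 < e -> exists N, forall n, (N <= n)%N ->
      \int[mu]_x `|h n x - g x| <= e].
Proof.
move=> AD mf M0 fM fh.
have [k /all_and2 [fk kM]] := choice (fun m =>
  let: ex_intro2 h a b := bounded_version mu (sigma_join_sub m) mf M0 fM in
  ex_intro (fun h => version mu _ f h /\ forall x, `|h x| <= M) h (conj a b)).
have [g [fg gM kg]] := reverse_martingale_L1_cvg sigma_join_sub sigma_join_le kM fk.
exists g; split=> // e e0; have [mg g1 _] := fg.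
(* The distance of [s n] and [g] enters twice, in the contraction estimate and in the final triangle
   inequality; the distance of [k n] and [g] enters once. *)
have e3 : 0 < e / 3 by rewrite divr_gt0.
have [s [sm [N NP]]] := approaches_bounded upper_limit_sub AD mg gM e3.
have [N' N'P] := kg _ e3.
exists (maxn N N') => n; rewrite geq_max => /andP[/NP n1 /N'P n2].
have [_ h1 _] := fh n; have [_ k1 _] := fk n; have [ms s1] := sm n.
have AM : A n `<=` measurable by have [] := A_sub n.
(* h n - s n is the conditional expectation of k n - s n, so the contraction
   property bounds it by |k n - g| + |g - s n| *)
have v : version mu (A n) (fun x => k n x - s n x) (fun x => h n x - s n x).
  apply: (versionB AM k1 s1 _ (version_id s1 ms)).
  apply: version_tower (fh n) (fk n).
  by apply: subset_trans (@sub_sigma_join n) _; exact: sub_sigma_algebra.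
have := version_contraction AM (L1B k1 s1) v.
have := Rintegral_norm_triangle h1 s1 g1.
have := Rintegral_norm_triangle k1 g1 s1.
rewrite (@eq_Rintegral _ _ _ _ _ (fun x => `|s n x - g x|) (fun x => `|g x - s n x|)).
  by move: n1 n2 => n1 n2 n3 n4 n5; rewrite (_ : e = e / 3 + e / 3 + e / 3); lra.
by move=> x _; rewrite distrC.
Qed.

End upper_limit.

(** * Convexity and Jensen's inequality *)

Section convex_real.
Context (R : realType).
Implicit Types (psi : R -> R).

Definition convexR psi := forall t x y : R, 0 <= t <= 1 ->
  psi (t * x + (1 - t) * y) <= t * psi x + (1 - t) * psi y.

Lemma convex_functionR psi :
  convex_function (E := R^o) [set: R^o] psi -> convexR psi.
Proof.
move=> cpsi t x y /andP[t0 t1].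
by have := cpsi (Itv01 t0 t1) x y; rewrite !inE !convRE/=; apply.
Qed.

(** Convexity with weight [(r - q) / (r - p)] on [p], multiplied out so that secant slopes can be
    compared by [nra]. *)
Lemma convexR_chord psi p q r : convexR psi -> p < q -> q < r ->
  (r - p) * psi q <= (r - q) * psi p + (q - p) * psi r.
Proof.
move=> cpsi pq qr; have pr : 0 < r - p by lra.
have pr0 : r - p != 0 by rewrite gt_eqF.
have t01 : 0 <= (r - q) / (r - p) <= 1.
  by rewrite divr_ge0 ?ler_pdivrMr// ?mul1r ?subr_ge0 ?(ltW qr) ?(ltW pr)//=; lra.
have := cpsi _ p r t01; set t := (r - q) / (r - p).
rewrite (_ : t * p + (1 - t) * r = q); last by rewrite /t; field.
rewrite -(ler_pM2l pr) => /le_trans; apply; rewrite le_eqVlt; apply/orP; left.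
by apply/eqP; rewrite /t; field.
Qed.

(** The slope is the supremum of the secant slopes to the left of [x], all of which lie below every
    secant slope to the right. *)
Lemma convexR_subgradient psi x : convexR psi ->
  exists a, forall y, psi x + a * (y - x) <= psi y.
Proof.
move=> cpsi; pose S := [set (psi x - psi p) / (x - p) | p in [set p | p < x]].
have Sub r : x < r -> ubound S ((psi r - psi x) / (r - x)).
  move=> xr _ [p /= px <-].
  rewrite ler_pdivrMr ?subr_gt0// mulrAC ler_pdivlMr ?subr_gt0//.
  by have := convexR_chord cpsi px xr; nra.
have Sn : S !=set0 by exists ((psi x - psi (x - 1)) / (x - (x - 1))); exists (x - 1) => //=; lra.
have hS : has_sup S.
  by split => //; exists ((psi (x + 1) - psi x) / (x + 1 - x)); apply: Sub; lra.
exists (sup S) => y; have [yx|xy|->] := ltgtP y x; last by rewrite subrr mulr0 addr0.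
- have : (psi x - psi y) / (x - y) <= sup S by apply: ub_le_sup; [case: hS|exists y].
  by rewrite ler_pdivrMr ?subr_gt0//; nra.
- have : sup S <= (psi y - psi x) / (y - x) by apply: ge_sup => //; exact: Sub.
  by rewrite ler_pdivlMr ?subr_gt0//; nra.
Qed.

(** Adding the supporting inequalities at [x] and at [y] gives monotonicity for any choice of
    slopes. Monotonicity in turn yields measurability, and boundedness on bounded intervals. *)
Lemma convexR_subgradient_fun psi : convexR psi -> exists a : R -> R,
  {homo a : x y / x <= y} /\ forall x y, psi x + a x * (y - x) <= psi y.
Proof.
move=> cpsi; have [a aP] := choice (fun x => convexR_subgradient x cpsi).
exists a; split=> // x y; rewrite le_eqVlt => /predU1P[->//|xy].
have := aP x y; have := aP y x => h1 h2.
by rewrite -(ler_pM2r (_ : 0 < y - x)) ?subr_gt0//; nra.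
Qed.

End convex_real.

(** * Sublevel sets, Jensen's inequality for versions, truncation *)

Section truncation.
Context d (T : measurableType d) (R : realType).
Variable mu : {finite_measure set T -> \bar R}.
Implicit Types (D : set (set T)) (f g : T -> R).

Definition sublevel g (n : nat) : set T := g @^-1` `[- n%:R, n%:R]%classic.

Lemma sublevelP g n x : sublevel g n x <-> `|g x| <= n%:R.
Proof. by rewrite /sublevel /= in_itv/= ler_norml. Qed.

Lemma measurable_sublevel g n : measurable_fun [set: T] g ->
  measurable (sublevel g n).
Proof. by move=> mg; rewrite -[sublevel _ _]setTI; exact: mg. Qed.

Lemma sublevel_integral_cvg g (h : T -> \bar R) : measurable_fun [set: T] g ->
  measurable_fun [set: T] h -> (forall x, 0 <= h x)%E ->
  (\int[mu]_(x in sublevel g n) h x)%E @[n --> \oo] --> (\int[mu]_x h x)%E.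
Proof.
move=> mg mh h0.
have <- : \bigcup_n sublevel g n = [set: T].
  apply/seteqP; split=> // x _; exists (Num.bound (g x)) => //.
  by apply/sublevelP; rewrite (le_trans (ltW (archi_boundP (normr_ge0 _))))// /Num.bound normr_id.
apply: ge0_nondecreasing_set_cvg_integral => //.
- move=> m n mn; apply/subsetPset => x /sublevelP gx; apply/sublevelP.
  by rewrite (le_trans gx)// ler_nat.
- by move=> n; exact: measurable_sublevel.
- by move=> n; exact: measurable_funS mh.
Qed.

(** The supporting line at [g x] is integrated over the set where [|g| <= n]. There the slope is
    bounded, hence a weight for [D], and the linear term integrates to zero; then [n] tends to
    infinity. *)
Lemma conditional_jensen (psi : R -> R) D f g : convexR psi ->
    measurable_fun [set: R] psi -> (forall x, 0 <= psi x) ->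
    sigma_subalgebra D -> L1 mu f -> version mu D f g ->
  (\int[mu]_x (psi (g x))%:E <= \int[mu]_x (psi (f x))%:E)%E.
Proof.
move=> cpsi mpsi psi0 [sD DM] f1 [mg g1 fg].
have mfT := L1_measurable f1; have mgT := L1_measurable g1.
have mpf : measurable_fun [set: T] (psi \o f) by exact: measurableT_comp.
have mpg : measurable_fun [set: T] (psi \o g) by exact: measurableT_comp.
have [->|] := eqVneq (\int[mu]_x (psi (f x))%:E)%E +oo%E; first by rewrite leey.
rewrite -ltey => pffin.
have pf1 : L1 mu (psi \o f).
  apply/integrableP; split; first exact/measurable_EFinP.
  by under eq_integral do rewrite /= ger0_norm//.
have [a [ahomo aP]] := convexR_subgradient_fun cpsi.
have cvgE := @sublevel_integral_cvg g (fun x => (psi (g x))%:E) mgT.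
rewrite -(cvg_lim _ (cvgE _ _))//; [|exact/measurable_EFinP|by move=> x; rewrite lee_fin].
apply: lime_le.
  by apply/cvg_ex; eexists; apply: cvgE; [exact/measurable_EFinP|by move=> x; rewrite lee_fin].
apply: nearW => n; set E := sublevel g n.
have mE : measurable E by exact: measurable_sublevel.
have DE : D E by exact: measurable_wrt_preimage.
pose w x := a (g x) * \1_E x.
have mw : measurable_wrt D w.
  apply: measurable_funM; last exact: measurable_wrt_indic.
  by apply: measurableT_comp mg; exact: nondecreasing_measurable.
have mwT := measurable_wrtW DM mw.
(* On [E] the values of [g] lie in [[- n, n]], so the monotone slope lies between [a (- n%:R)] and
   [a n%:R]. *)
pose C := Num.max `|a n%:R| `|a (- n%:R)|.
have wC x : `|w x| <= C.
  rewrite /w indicE; have [|_] := boolP (x \in E); last first.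
    by rewrite mulr0 normr0 le_max normr_ge0.
  rewrite inE /E /sublevel /= in_itv/= mulr1 => /andP[/ahomo a1 /ahomo a2].
  rewrite ler_norml /C; apply/andP; split.
    rewrite lerNl (@le_trans _ _ `|a (- n%:R)|) ?le_max ?lexx ?orbT//.
    by have := ler_norm (- a (- n%:R)); rewrite normrN; lra.
  by rewrite (le_trans a2)// (le_trans (ler_norm _))// le_max lexx.
have i1 : L1 mu (fun x => psi (f x) * \1_E x).
  by apply: L1M pf1 _ (normr_indic_le1 _ E); exact: measurable_indic.
have i2 := L1M f1 mwT wC; have i3 := L1M g1 mwT wC.
have ub x : psi (g x) * \1_E x <= psi (f x) * \1_E x - (f x * w x - g x * w x).
  rewrite /w indicE; case: (x \in E); rewrite ?mulr1 ?mulr0 ?subr0//=.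
  by have := aP (g x) (f x); lra.
have i4 : L1 mu (fun x => psi (g x) * \1_E x).
  apply: (@L1_le _ _ _ _ _ (fun x => psi (f x) * \1_E x - (f x * w x - g x * w x))).
  - by apply: measurable_funM => //; exact: measurable_indic.
  - by apply: L1B => //; exact: L1B.
  - by move=> x; rewrite ger0_norm// mulr_ge0// indicE.
have : \int[mu]_x (psi (g x) * \1_E x) <= \int[mu]_x (psi (f x)).
  apply: le_trans (ler_Rintegral i4 _ ub) _; first by apply: L1B => //; exact: L1B.
  rewrite RintegralB//; last exact: L1B.
  rewrite RintegralB// (fg _ _ mw wC) subrr subr0.
  apply: ler_Rintegral => // x.
  by rewrite indicE; case: (x \in E); rewrite ?mulr1 ?mulr0.
rewrite -lee_fin !EFin_Rintegral// => /(le_trans _); apply.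
rewrite le_eqVlt; apply/orP; left; apply/eqP.
rewrite integral_mkcond; apply: eq_integral => x _.
by rewrite patchE indicE; case: (x \in E); rewrite ?mulr1 ?mulr0.
Qed.

Lemma conditional_jensen_L1 (psi : R -> R) D f g : convexR psi ->
    measurable_fun [set: R] psi -> (forall x, 0 <= psi x) ->
    sigma_subalgebra D -> L1 mu f -> L1 mu (psi \o f) -> version mu D f g ->
  L1 mu (psi \o g) /\ \int[mu]_x psi (g x) <= \int[mu]_x psi (f x).
Proof.
move=> cpsi mpsi psi0 sD f1 pf1 fg.
have le := conditional_jensen cpsi mpsi psi0 sD f1 fg.
have pg1 : L1 mu (psi \o g).
  apply/integrableP; split.
    by apply/measurable_EFinP/measurableT_comp => //; case: fg => _ /L1_measurable.
  under eq_integral do rewrite /= ger0_norm//.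
  by apply: le_lt_trans le _; exact: (integrable_lty _ pf1).
by split=> //; rewrite -lee_fin !EFin_Rintegral.
Qed.

(** With [u] equal to [f] where [|f| <= n] and to 0 elsewhere, [h 0 = 0] makes [h (f - u)] the part
    of [h f] off that set, whose integral tends to 0. *)
Lemma truncation_tail f (h : R -> R) (e : R) : measurable_fun [set: T] f ->
    measurable_fun [set: R] h -> (forall x, 0 <= h x) -> h 0 = 0 ->
    L1 mu (h \o f) -> 0 < e ->
  exists (u : T -> R) (M : R), [/\ measurable_fun [set: T] u, 0 <= M, forall x, `|u x| <= M,
    L1 mu (fun x => h (f x - u x)) & \int[mu]_x h (f x - u x) <= e].
Proof.
move=> mf mh h0 h00 hf1 e0.
have mhf := L1_measurable hf1.
have cvgE := @sublevel_integral_cvg f (fun x => (h (f x))%:E) mf.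
have {cvgE}/fine_cvgP[_ /cvgrPdist_le /(_ _ e0) [n _ /(_ n (leqnn n)) /= nP]] :
    (\int[mu]_(x in sublevel f n) (h (f x))%:E)%E @[n --> \oo] -->
    (\int[mu]_x h (f x))%:E.
  by rewrite EFin_Rintegral//; apply: cvgE; [exact/measurable_EFinP|move=> x; rewrite lee_fin].
have {nP} : `|\int[mu]_x h (f x) - \int[mu]_(x in sublevel f n) h (f x)| <= e by [].
set E := sublevel f n => nP; have mE : measurable E by exact: measurable_sublevel.
have hE1 : L1 mu (fun x => h (f x) * \1_E x).
  by apply: L1M hf1 _ (normr_indic_le1 _ E); exact: measurable_indic.
have eqh x : h (f x - f x * \1_E x) = h (f x) - h (f x) * \1_E x.
  by rewrite indicE; case: (x \in E); rewrite ?mulr1 ?mulr0 ?subrr ?subr0.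
exists (fun x => f x * \1_E x), n%:R; split=> //.
- by apply: measurable_funM => //; exact: measurable_indic.
- move=> x; rewrite indicE; have [/set_mem/sublevelP|_] := boolP (x \in E).
    by rewrite mulr1.
  by rewrite mulr0 normr0.
- by under eq_fun do rewrite eqh; exact: L1B.
- under eq_Rintegral do rewrite eqh.
  rewrite RintegralB// Rintegral_indic//.
  exact: le_trans (ler_norm _) nP.
Qed.

End truncation.

(** * Young functions and Orlicz spaces *)

Section young.
Context (R : realType) (phi : R -> R).
Hypothesis Y : young_function phi.

Lemma young_convexR : convexR phi.
Proof. exact: convex_functionR (young_convex Y). Qed.

Lemma young0 : phi 0 = 0.
Proof. exact/(young_eq0 Y). Qed.

Lemma young_measurable : measurable_fun [set: R] phi.
Proof. exact: continuous_measurable_fun (young_continuous Y). Qed.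

(** 0 is the midpoint of [x] and [- x], where [phi] takes equal values. *)
Lemma young_ge0 x : 0 <= phi x.
Proof.
have := @young_convexR 2^-1 x (- x); rewrite (young_even Y).
rewrite (_ : _ + _ = 0 :> R); last by field.
by rewrite young0 => /(_ ltac:(lra)); lra.
Qed.

Lemma young_scale t x : 0 <= t <= 1 -> phi (t * x) <= t * phi x.
Proof. by move/(@young_convexR _ x 0); rewrite young0 !mulr0 !addr0. Qed.

Lemma young_norm x : phi `|x| = phi x.
Proof. by case: (ler0P x) => _ //; exact: young_even Y x. Qed.

Lemma young_homo x y : `|x| <= `|y| -> phi x <= phi y.
Proof.
move=> xy; rewrite -young_norm -(young_norm y).
have [y0|y0] := eqVneq `|y| 0.
  by have -> : `|x| = `|y| by apply/eqP; rewrite eq_le xy y0 normr_ge0.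
have yp : 0 < `|y| by rewrite lt_neqAle eq_sym y0 normr_ge0.
have t01 : 0 <= `|x| / `|y| <= 1 by rewrite divr_ge0//= ler_pdivrMr// mul1r.
have := young_scale `|y| t01; rewrite divfK// => /le_trans; apply.
by rewrite ler_piMl ?young_ge0//; case/andP: t01.
Qed.

Lemma young_coerciveP K : exists2 X : R, 0 < X & forall x, X <= `|x| -> K <= phi x.
Proof.
have /cvgryPge /(_ K) [X [_ XP]] := young_coercive Y.
exists (`|X| + 1); first by rewrite ltr_wpDl.
move=> x Xx; rewrite -young_norm; apply: XP.
by apply: lt_le_trans Xx; rewrite ltr_pwDr// ler_norm.
Qed.

Lemma young_superlinearP : exists2 X : R, 0 <= X & forall x, `|x| <= X + phi x.
Proof.
have /cvgryPge /(_ 1) [X [_ XP]] := young_superlinear Y.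
exists (`|X| + 1); first by rewrite addr_ge0.
move=> x; have [xX|Xx] := leP `|x| (`|X| + 1).
  by rewrite (le_trans xX)// lerDl young_ge0.
have xp : 0 < `|x| by apply: lt_trans Xx; rewrite ltr_wpDl.
have /XP : X < `|x| by rewrite (le_lt_trans _ Xx)// ler_wpDr// ler_norm.
rewrite /= ler_pdivlMr// mul1r young_norm => /le_trans; apply.
by rewrite lerDr addr_ge0.
Qed.

(** Convexity is used twice: for the midpoint of [b] and [- c], then with weight 1/3 on [a].
    Evenness removes the sign of [c]. *)
Lemma young_third a b c : phi ((a + b - c) / 3) <=
  3^-1 * (phi a + phi b + phi c).
Proof.
have := @young_convexR (3^-1) a ((b - c) / 2).
have := @young_convexR (2^-1) b (- c).
rewrite (young_even Y) (_ : 2^-1 * b + _ = (b - c) / 2); last by field.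
rewrite (_ : 3^-1 * a + _ = (a + b - c) / 3); last by field.
by move=> /(_ ltac:(lra)) h1 /(_ ltac:(lra)) h2; lra.
Qed.

(** The constant [phi (2 * x0)] absorbs all arguments below [x0]; being integrable over a finite
    measure space, it does no harm. *)
Lemma Delta2_affine : Delta2 phi ->
  exists k b : R, [/\ 0 <= k, 0 <= b & forall x, phi (2 * x) <= k * phi x + b].
Proof.
move=> [k [x0 [k0 x00 kP]]]; exists k, (phi (2 * x0)).
split; [exact: ltW|exact: young_ge0|move=> x].
have -> : phi (2 * x) = phi (2 * `|x|).
  by rewrite -young_norm normrM ger0_norm.
rewrite -(young_norm x); have [xx|xx] := leP x0 `|x|.
  by rewrite (le_trans (kP _ xx))// lerDl young_ge0.
rewrite ler_wpDl ?mulr_ge0 ?young_ge0 ?(ltW k0)//.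
by apply: young_homo; rewrite !normrM normr_id ler_wpM2l// (gtr0_norm x00) ltW.
Qed.

End young.

(** * Integrability in the Orlicz space, and norms tending to zero *)

Section orlicz_facts.
Context d (T : measurableType d) (R : realType).
Variable mu : {finite_measure set T -> \bar R}.
Variable phi : R -> R.
Hypothesis Y : young_function phi.
Implicit Types f : T -> R.

Lemma young_comp_L1 f : measurable_fun [set: T] f ->
  (\int[mu]_x (phi (f x))%:E < +oo)%E -> L1 mu (phi \o f).
Proof.
move=> mf fy; apply/integrableP; split.
  by apply/measurable_EFinP/measurableT_comp => //; exact: young_measurable Y.
by under eq_integral do rewrite /= ger0_norm ?(young_ge0 Y)//.
Qed.

(** Starting from an admissible factor [a], doubling by Delta_2 reaches [2 ^+ n * a >= |c|];
    monotonicity of [phi] in [|x|] does the rest. *)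
Lemma orlicz_space_scale f c : Delta2 phi -> orlicz_space mu phi f ->
  L1 mu (fun x => phi (c * f x)).
Proof.
move=> /(Delta2_affine Y)[k [b [k0 b0 kP]]] [mf [a a0 fa]].
have mp e : measurable_fun [set: T] (fun x => phi (e * f x)).
  by apply: measurableT_comp; [exact: young_measurable Y|exact: measurable_funM].
have dbl n : L1 mu (fun x => phi (2 ^+ n * a * f x)).
  elim: n => [|n IH].
    rewrite expr0 mul1r; apply: (@young_comp_L1 (fun x => a * f x)) => //.
    exact: measurable_funM.
  apply: (@L1_le _ _ _ _ _ (fun x => k * phi (2 ^+ n * a * f x) + b)) => //.
    by apply: L1D; [exact: L1Z|exact: L1_cst].
  by move=> x; rewrite ger0_norm ?(young_ge0 Y)// exprS -!mulrA [_ * (a * _)]mulrA.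
pose n := Num.bound (`|c| / a).
have cn : `|c| <= 2 ^+ n * a.
  by rewrite -ler_pdivrMr// ltW//; exact: upper_nthrootP.
apply: (L1_le _ (dbl n)) => // x; rewrite ger0_norm ?(young_ge0 Y)//.
apply: (young_homo Y); rewrite !normrM ler_wpM2r// (le_trans cn)//.
by rewrite -normrM ler_norm.
Qed.

Lemma orlicz_space_L1 f : orlicz_space mu phi f -> L1 mu f.
Proof.
move=> [mf [a a0 fa]]; have [X X0 XP] := young_superlinearP Y.
have h1 : L1 mu (fun x => a * f x).
  apply: (@L1_le _ _ _ _ _ (fun x => X + phi (a * f x))) => //.
    exact: measurable_funM.
  apply: L1D; first exact: L1_cst.
  by apply: (@young_comp_L1 (fun x => a * f x)) => //; exact: measurable_funM.
have := L1Z a^-1 h1; congr (L1 mu _); apply/funext => x.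
by rewrite mulKf// gt_eqF.
Qed.

Lemma orlicz_norm_ge0 f : (0 <= orlicz_norm mu phi f)%E.
Proof. by apply: le_ereal_inf_tmp => _ [k [k0 _] <-]; rewrite lee_fin ltW. Qed.

(** The norm is extended-real, so convergence to 0 also contains eventual finiteness, which an
    eventual bound by a real number supplies. *)
Lemma orlicz_norm_cvg0 (f : (T -> R)^nat) :
  (orlicz_norm mu phi (f n) @[n --> \oo] --> 0%E) <->
  forall e : R, 0 < e -> exists N, forall n, (N <= n)%N ->
    (orlicz_norm mu phi (f n) <= e%:E)%E.
Proof.
have H0 n := orlicz_norm_ge0 (f n).
split=> [/fine_cvgP[[N1 _ N1P] /cvgr0Pnorm_le cv] e e0|H].
  have [N2 _ N2P] := cv _ e0; exists (maxn N1 N2) => n.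
  rewrite geq_max => /andP[/N1P n1 /N2P /= n2].
  by rewrite -(fineK n1) lee_fin (le_trans (ler_norm _)).
have fin e n : (orlicz_norm mu phi (f n) <= e%:E)%E -> orlicz_norm mu phi (f n) \is a fin_num.
  by move=> ne; rewrite ge0_fin_numE// (le_lt_trans ne)// ltry.
apply/fine_cvgP; split.
  by have [N NP] := H 1 ltr01; exists N => // n /NP /fin.
apply/cvgr0Pnorm_le => e e0; have [N NP] := H e e0; exists N => // n /NP /= ne.
by rewrite ger0_norm ?fine_ge0// -lee_fin fineK// (fin e).
Qed.

End orlicz_facts.

(** * Norm convergence of conditional expectations and approximation in measure *)

Section orlicz_convergence.
Context d (T : measurableType d) (R : realType).
Variable mu : {finite_measure set T -> \bar R}.
Variables (phi : R -> R) (A : (set (set T))^nat).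
Hypothesis Y : young_function phi.
Hypothesis A_sub : forall n, sigma_subalgebra (A n).

(** Convexity between 0 and [c * M], with weight [|g x| / M]. For functions with a common bound, L^1
    convergence to 0 thus forces the integrals of [phi (c * g)] to 0. *)
Lemma young_Rintegral_bounded c M (g : T -> R) : 0 < M ->
    measurable_fun [set: T] g -> (forall x, `|g x| <= M) ->
  L1 mu (fun x => phi (c * g x)) /\
    \int[mu]_x phi (c * g x) <= phi (c * M) / M * \int[mu]_x `|g x|.
Proof.
move=> M0 mg gM; have g1 := L1_bounded mu mg gM.
have le x : phi (c * g x) <= phi (c * M) / M * `|g x|.
  have t01 : 0 <= `|g x| / M <= 1.
    by rewrite divr_ge0 ?(ltW M0)//= ler_pdivrMr// mul1r.
  have -> : phi (c * g x) = phi (`|g x| / M * (c * M)).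
    rewrite mulrCA divfK ?gt_eqF// -(young_norm Y) -[RHS](young_norm Y).
    by rewrite !normrM normr_id.
  by apply: (le_trans (young_scale Y _ t01)); rewrite mulrC mulrCA mulrC.
have pg1 : L1 mu (fun x => phi (c * g x)).
  apply: (@L1_le _ _ _ _ _ (fun x => phi (c * M) / M * `|g x|)).
  - apply: measurableT_comp; first exact: young_measurable Y.
    exact: measurable_funM.
  - exact/L1Z/L1_norm.
  - by move=> x; rewrite ger0_norm ?(young_ge0 Y).
split=> //; rewrite -RintegralZl//; last exact: L1_norm.
by apply: ler_Rintegral => //; exact/L1Z/L1_norm.
Qed.

Lemma orlicz_cvg_of_approaches f : Delta2 phi ->
    approaches_in_measure mu A (upper_limit A) -> orlicz_space mu phi f ->
  orlicz_norm mu phi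
    (fun x => cond_exp mu (A n) f x - cond_exp mu (upper_limit A) f x)
    @[n --> \oo] --> 0%E.
Proof.
move=> D2 AD of_; apply: (orlicz_norm_cvg0 mu phi (fun n x =>
  cond_exp mu (A n) f x - cond_exp mu (upper_limit A) f x)).2 => e e0.
have f1 := orlicz_space_L1 Y of_; have mf := L1_measurable f1.
(* Writing [p n - q] as [(h n - g) + (p n - h n) - (q - g)], [young_third] bounds
   [phi (|p n - q| / e)] by the mean of three values of [psi]. It suffices that each has integral at
   most 1, for then [e] is admissible in the infimum. *)
pose c := 3 / e.
pose psi x := phi (c * x).
have mpsi : measurable_fun [set: R] psi.
  by apply: measurableT_comp; [exact: young_measurable Y|exact: measurable_funM].
have psi0 x : 0 <= psi x := young_ge0 Y (c * x).
have cpsi : convexR psi.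
  move=> t x y t01; rewrite /psi (_ : c * _ = t * (c * x) + (1 - t) * (c * y)); last by ring.
  exact: young_convexR.
have [|u [M [mu_ M0 uM pv1 pv]]] := truncation_tail mf mpsi psi0 _
  (orlicz_space_scale Y c D2 of_) ltr01.
  by rewrite /psi mulr0 (young0 Y).
have u1 := L1_bounded mu mu_ uM.
have [h /all_and2 [uh hM]] := choice (fun n =>
  let: ex_intro2 h a b := bounded_version mu (A_sub n) mu_ M0 uM in
  ex_intro (fun h => version mu (A n) u h /\ forall x, `|h x| <= M) h (conj a b)).
have [g [ug gM hg]] := bounded_version_L1_cvg A_sub AD mu_ M0 uM uh.
have sD := upper_limit_sub A_sub.
pose p n := cond_exp mu (A n) f; pose q := cond_exp mu (upper_limit A) f.
have fp n : version mu (A n) f (p n) by exact: cond_exp_version.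
have fq : version mu (upper_limit A) f q by exact: cond_exp_version.
have v1 := L1B f1 u1.
have tail D r s : sigma_subalgebra D -> version mu D f r -> version mu D u s ->
    L1 mu (fun x => psi (r x - s x)) /\ \int[mu]_x psi (r x - s x) <= 1.
  move=> sD' fr us.
  have vv := versionB sD'.2 f1 u1 fr us.
  have [i1 i2] := conditional_jensen_L1 cpsi mpsi psi0 sD' v1 pv1 vv.
  by split=> //; exact: le_trans pv.
have [q1 q2] := tail _ _ _ sD fq ug.
(* [2 * M] bounds [|h n - g|]; the summand 1 keeps the bound positive when [M = 0]. *)
have M'0 : 0 < 2 * M + 1 by lra.
pose K := psi (2 * M + 1) / (2 * M + 1).
have K0 : 0 <= K by rewrite divr_ge0 ?(ltW M'0).
have [N NP] := hg ((K + 1)^-1) ltac:(by rewrite invr_gt0 ltr_wpDl).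
exists N => n /NP {}NP.
have [p1 p2] := tail _ _ _ (A_sub n) (fp n) (uh n).
have [mh h1 _] := uh n; have [mg g1 _] := ug.
have [||b1 b2] := @young_Rintegral_bounded c (2 * M + 1) (fun x => h n x - g x) M'0.
- exact: L1_measurable (L1B h1 g1).
- move=> x; rewrite (le_trans (ler_normB _ _))//.
  by have := hM n x; have := gM x; lra.
have {}b2 : \int[mu]_x psi (h n x - g x) <= 1.
  apply: (le_trans b2); rewrite -/(psi _) -/K.
  apply: (le_trans (ler_wpM2l K0 NP)).
  by rewrite ler_pdivrMr ?ltr_wpDl// mul1r lerDl.
apply: ereal_inf_lbound; exists e => //; split=> //.
have split3 x : phi (`|p n x - q x| / e) <=
    3^-1 * (psi (h n x - g x) + psi (p n x - h n x) + psi (q x - g x)).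
  rewrite -(young_norm Y) normrM normr_id -normrM (young_norm Y).
  rewrite (_ : (p n x - q x) / e = (c * (h n x - g x) + c * (p n x - h n x) -
    c * (q x - g x)) / 3); first exact: young_third.
  by rewrite /c; field; rewrite gt_eqF.
have s1 : L1 mu (fun x => psi (h n x - g x) + psi (p n x - h n x) + psi (q x - g x)).
  by apply: L1D => //; exact: L1D.
have pq1 := L1B (let: And3 _ a _ := fp n in a) (let: And3 _ a _ := fq in a).
have l1 : L1 mu (fun x => phi (`|p n x - q x| / e)).
  apply: (L1_le _ (L1Z 3^-1 s1)).
    apply: measurableT_comp; first exact: young_measurable Y.
    apply: measurable_funM => //; apply: measurableT_comp => //.
    exact: L1_measurable pq1.
  by move=> x; rewrite ger0_norm ?(young_ge0 Y).
rewrite -EFin_Rintegral// lee_fin.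
apply: (le_trans (ler_Rintegral l1 (L1Z 3^-1 s1) split3)).
rewrite RintegralZl// RintegralD//; last exact: L1D.
by rewrite RintegralD//; lra.
Qed.

Lemma approaches_of_orlicz_cvg :
    (forall f : T -> R, orlicz_space mu phi f ->
      orlicz_norm mu phi
        (fun x => cond_exp mu (A n) f x - cond_exp mu (upper_limit A) f x)
        @[n --> \oo] --> 0%E) ->
  approaches_in_measure mu A (upper_limit A).
Proof.
move=> cv B AB; have [sD DM] := upper_limit_sub A_sub.
have mB := DM _ AB.
pose f : T -> R := \1_B.
have f1 : L1 mu f by exact: integrable_indic.
have mf : measurable_fun [set: T] f by exact: measurable_indic.
have of_ : orlicz_space mu phi f.
  split=> //; exists 1 => //; apply: integrable_lty => //.
  apply: (@L1_bounded _ _ _ mu (fun x => phi (1 * f x)) (phi 1)).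
    by apply: measurableT_comp; [exact: young_measurable Y|exact: measurable_funM].
  move=> x; rewrite mul1r ger0_norm ?(young_ge0 Y)//; apply: (young_homo Y).
  by rewrite normr1 normr_indic_le1.
pose p n := cond_exp mu (A n) f; pose q := cond_exp mu (upper_limit A) f.
have fp n : version mu (A n) f (p n) by exact: cond_exp_version.
have fq : version mu (upper_limit A) f q by exact: cond_exp_version.
have [mq q1 _] := fq.
(* Both [q] and [f] are versions for [f], so [q - f] is a version for [f - f = 0] and the
   contraction property applies. *)
have qf : \int[mu]_x `|q x - f x| <= 0.
  have v := versionB DM f1 f1 fq (version_id f1 (measurable_wrt_indic AB)).
  apply: (le_trans (version_contraction DM (L1B f1 f1) v)).
  under eq_Rintegral do rewrite subrr normr0.
  by rewrite Rintegral_cst// mul0r.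
pose C n := p n @^-1` `]2^-1, +oo[%classic.
have AC n : A n (C n).
  by apply: measurable_wrt_preimage; [case: (A_sub n)|case: (fp n)|].
have mC n : measurable (C n) by have [_] := A_sub n; apply.
exists C; split=> //.
have mCB n : measurable (C n `+` B).
  by rewrite setY_def; apply: measurableU; exact: measurableD.
have H (e : R) : 0 < e -> exists N, forall n, (N <= n)%N -> fine (mu (C n `+` B)) <= e.
  move=> e0; have [X X0 XP] := young_coerciveP Y e^-1.
  (* A norm at most [(8 * X)^-1] is strictly below [(4 * X)^-1], so some admissible [k] is too. Then
     [|p n - q| >= 1/4] forces [|p n - q| / k >= X], where [phi] is at least [e^-1]. *)
  have X40 : 0 < (8 * X)^-1 by rewrite invr_gt0 mulr_gt0.
  have [N NP] := (orlicz_norm_cvg0 mu phi (fun n x => p n x - q x)).1 (cv _ of_) _ X40.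
  exists N => n /NP {}NP.
  have : (orlicz_norm mu phi (fun x => p n x - q x)%R < ((4 * X)^-1)%:E)%E.
    apply: (le_lt_trans NP); rewrite lte_fin ltf_pV2 ?posrE ?mulr_gt0//; lra.
  move=> /ereal_inf_lt[_ [k [k0 ki] <-]]; rewrite lte_fin => kX.
  have [_ p1 _] := fp n; have pq1 := L1B p1 q1.
  have mk : measurable_fun [set: T] (fun x => `|p n x - q x| / k).
    apply: measurable_funM => //; apply: measurableT_comp => //.
    exact: L1_measurable pq1.
  have k1 : L1 mu (fun x => phi (`|p n x - q x| / k)).
    by apply: (young_comp_L1 Y mk); exact: le_lt_trans ki (ltry _).
  have {}ki : \int[mu]_x phi (`|p n x - q x| / k) <= 1.
    by rewrite -lee_fin EFin_Rintegral.
  (* On the symmetric difference [|p n - f| >= 1/2], so either [|p n - q| >= 1/4] and the first term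
     is at least 1, or [|q - f| > 1/4] and the second is. Upon integration the first contributes at
     most [e], the second nothing. *)
  have le x : \1_(C n `+` B) x <= e * phi (`|p n x - q x| / k) + 4 * `|q x - f x|.
    have r0 : 0 <= e * phi (`|p n x - q x| / k) + 4 * `|q x - f x|.
      by rewrite addr_ge0 ?mulr_ge0 ?(young_ge0 Y) ?(ltW e0).
    rewrite indicE; have [xCB|_] := boolP (x \in _) => //=.
    have [qp|pq] := leP 4^-1 `|p n x - q x|.
      apply: (@le_trans _ _ (e * phi (`|p n x - q x| / k))); last by rewrite lerDl mulr_ge0.
      rewrite -ler_pdivrMl// mulr1; apply: XP.
      rewrite ger0_norm ?divr_ge0 ?(ltW k0)// ler_pdivlMr//.
      rewrite (le_trans _ qp)// mulrC -ler_pdivlMr//.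
      by rewrite -invfM ltW.
    have pf : 2^-1 <= `|p n x - f x|.
      move: xCB; rewrite setY_def in_setU !in_setD /f indicE.
      have -> : (x \in C n) = (2^-1 < p n x).
        by apply/idP/idP; rewrite inE /C /= in_itv/= andbT.
      case: ltP => px; case: (x \in B) => //= _; rewrite ?subr0.
        by rewrite ger0_norm; lra.
      by rewrite ler0_norm; lra.
    have := ler_distD (q x) (p n x) (f x).
    have := mulr_ge0 (ltW e0) (young_ge0 Y (`|p n x - q x| / k)).
    by lra.
  have qf1 := L1B q1 f1.
  have -> : fine (mu (C n `+` B)) = \int[mu]_x \1_(C n `+` B) x.
    by rewrite /Rintegral integral_indic// setIT.
  have r1 : L1 mu (fun x => e * phi (`|p n x - q x| / k)) by exact: L1Z.
  have r2 : L1 mu (fun x => 4 * `|q x - f x|) by exact/L1Z/L1_norm.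
  apply: (le_trans (ler_Rintegral _ (L1D r1 r2) le)); first exact: integrable_indic.
  rewrite RintegralD// !RintegralZl//; last exact: L1_norm.
  have : e * \int[mu]_x phi (`|p n x - q x| / k) <= e by rewrite ler_piMr// ltW.
  by lra.
apply/fine_cvgP; split; first by apply: nearW => n; exact: fin_num_measure.
apply/cvgr0Pnorm_le => e e0; have [N NP] := H e e0; exists N => // n /NP /= ne.
by rewrite ger0_norm ?fine_ge0.
Qed.

End orlicz_convergence.

Theorem lemma2p7 (d : measure_display) (T : measurableType d) (R : realType)
    (mu : {finite_measure set T -> \bar R}) (phi : R -> R)
    (A : nat -> set (set T))
    (mu_complete : measure_is_complete mu)
    (phi_young : young_function phi)
    (phi_Delta2 : Delta2 phi)
    (A_sub : forall n, sigma_subalgebra (A n)) :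
  approaches_in_measure mu A (upper_limit A)
  <->
  forall f : T -> R, orlicz_space mu phi f ->
    orlicz_norm mu phi
      (fun x => cond_exp mu (A n) f x - cond_exp mu (upper_limit A) f x)
      @[n --> \oo] --> 0%E.
Proof.
split=> [AD f|]; first exact: orlicz_cvg_of_approaches.
exact: approaches_of_orlicz_cvg.
Qed.
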